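(* Every nilpotent superconnected quandle is latin.
   Context: A left quasigroup is an algebra $(Q,*,\backslash)$ satisfying $x\backslash(x*y)=y=x*(x\backslash y)$; equivalently every left multiplication $L_a:b\mapsto a*b$ is a bijection of $Q$. A quandle is a left quasigroup satisfying $x*(y*z)=(x*y)*(x*z)$ and $x*x=x$. Subalgebras are subsets closed under $*$ and $\backslash$; congruences are equivalence relations compatible with both operations. $\mathrm{LMlt}(Q)=\langle L_a:a\in Q\rangle$. $Q$ is connected if $\mathrm{LMlt}(Q)$ is transitive on $Q$, and superconnected if every subalgebra is connected (with respect to its own left multiplication group). $Q$ is latin if also every right multiplication $R_a:b\mapsto b*a$ is a bijection of $Q$. Quandles may be infinite. Nilpotence is in the sense of Freese and McKenzie commutator theory: for congruences $\alpha,\beta$, $[\alpha,\beta]$ is the smallest congruence $\delta$ such that for every term $t(x,y_1,\dots,y_n)$ in $*,\backslash$, all $a\,\alpha\,b$ and $u_i\,\beta\,v_i$, $t(a,u_1,\dots,u_n)\,\delta\,t(a,v_1,\dots,v_n)$ implies $t(b,u_1,\dots,u_n)\,\delta\,t(b,v_1,\dots,v_n)$. Put $1_Q=Q\times Q$, $0_Q=\{(a,a):a\in Q\}$, $\gamma_0(Q)=1_Q$ and $\gamma_{n+1}(Q)=[\gamma_n(Q),1_Q]$; $Q$ is nilpotent if $\gamma_n(Q)=0_Q$ for some $n\in\mathbb N$. (It is known that a quandle $Q$ is nilpotent if and only if the group $\mathrm{Dis}(Q)=\langle L_aL_b^{-1}:a,b\in Q\rangle$ is nilpotent.) *)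

(* Defs.v *)
From HB Require Import structures.
From mathcomp Require Import all_boot.
From mathcomp Require Import boolp classical_sets.

Set Implicit Arguments.
Unset Strict Implicit.
Unset Printing Implicit Defensive.

Declare Scope quandle_scope.
Delimit Scope quandle_scope with Qd.
Local Open Scope quandle_scope.

(* The carrier is an arbitrary [Type], so quandles may be infinite. *)
HB.mixin Record isLeftQuasigroup Q := {
  lqmul : Q -> Q -> Q;
  lqdiv : Q -> Q -> Q;
  lqmulK : forall x y, lqdiv x (lqmul x y) = y;
  lqdivK : forall x y, lqmul x (lqdiv x y) = y
}.

#[short(type="leftQuasigroupType")]
HB.structure Definition LeftQuasigroup := { Q of isLeftQuasigroup Q }.

Notation "x * y" := (lqmul x y) : quandle_scope.
Notation "x \\ y" := (lqdiv x y)
  (at level 40, left associativity) : quandle_scope.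

HB.mixin Record LeftQuasigroup_isQuandle Q of LeftQuasigroup Q := {
  lqmulDr : forall x y z : Q, x * (y * z) = (x * y) * (x * z);
  lqmulxx : forall x : Q, x * x = x
}.

#[short(type="quandleType")]
HB.structure Definition Quandle :=
  { Q of LeftQuasigroup Q & LeftQuasigroup_isQuandle Q }.

Definition left_mul (Q : leftQuasigroupType) (a b : Q) : Q := a * b.
Definition right_mul (Q : leftQuasigroupType) (a b : Q) : Q := b * a.

Definition latin (Q : leftQuasigroupType) : Prop :=
  forall a : Q, bijective (right_mul a).

(* The subgroup of Sym(Q) generated by the left multiplications, as a predicate
   on functions; every function satisfying it is a bijection. *)
Inductive LMlt (Q : leftQuasigroupType) : (Q -> Q) -> Prop :=
| LMlt_gen (a : Q) : LMlt (left_mul a)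
| LMlt_id : LMlt (@id Q)
| LMlt_comp (f g : Q -> Q) : LMlt f -> LMlt g -> LMlt (f \o g)
| LMlt_inv (f g : Q -> Q) : LMlt f -> cancel f g -> cancel g f -> LMlt g.

Definition connected (Q : leftQuasigroupType) : Prop :=
  forall x y : Q, exists2 f : Q -> Q, LMlt f & f x = y.

Record subalgebra (Q : leftQuasigroupType) := Subalgebra {
  subalg_set :> set Q;
  subalg_mul : forall x y, subalg_set x -> subalg_set y -> subalg_set (x * y);
  subalg_div : forall x y, subalg_set x -> subalg_set y -> subalg_set (x \\ y)
}.

Definition subalg_sort (Q : leftQuasigroupType) (S : subalgebra Q) : Type :=
  set_type S.

Section SubalgebraStructure.
Variables (Q : leftQuasigroupType) (S : subalgebra Q).
Implicit Types x y : subalg_sort S.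

Definition subalg_sort_mul x y : subalg_sort S :=
  SigSub (mem_set (subalg_mul (set_valP x) (set_valP y))).

Definition subalg_sort_div x y : subalg_sort S :=
  SigSub (mem_set (subalg_div (set_valP x) (set_valP y))).

Fact subalg_sort_mulK x y : subalg_sort_div x (subalg_sort_mul x y) = y.
Proof. by apply: val_inj; rewrite /= lqmulK. Qed.

Fact subalg_sort_divK x y : subalg_sort_mul x (subalg_sort_div x y) = y.
Proof. by apply: val_inj; rewrite /= lqdivK. Qed.

HB.instance Definition _ := isLeftQuasigroup.Build (subalg_sort S)
  subalg_sort_mulK subalg_sort_divK.

End SubalgebraStructure.

Definition superconnected (Q : leftQuasigroupType) : Prop :=
  forall S : subalgebra Q, connected (subalg_sort S).

Inductive lqterm (V : Type) : Type :=
| TVar of V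
| TMul of lqterm V & lqterm V
| TDiv of lqterm V & lqterm V.

Fixpoint lqeval (Q : leftQuasigroupType) (V : Type) (e : V -> Q)
    (t : lqterm V) : Q :=
  match t with
  | TVar v => e v
  | TMul t1 t2 => lqeval e t1 * lqeval e t2
  | TDiv t1 t2 => lqeval e t1 \\ lqeval e t2
  end.

(* A term t(x, y_1, ..., y_n) has its variables in [option 'I_n]: [None] is the
   distinguished variable x and [Some i] is y_(i+1). *)
Definition lqeval1 (Q : leftQuasigroupType) (n : nat)
    (t : lqterm (option 'I_n)) (a : Q) (u : 'I_n -> Q) : Q :=
  lqeval (oapp u a) t.

Record congruence (Q : leftQuasigroupType) (r : Q -> Q -> Prop) : Prop := {
  congr_equiv : RelationClasses.Equivalence r;
  congr_mul : forall a b c d, r a b -> r c d -> r (a * c) (b * d);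
  congr_div : forall a b c d, r a b -> r c d -> r (a \\ c) (b \\ d)
}.

Definition term_condition (Q : leftQuasigroupType)
    (alpha beta delta : Q -> Q -> Prop) : Prop :=
  forall (n : nat) (t : lqterm (option 'I_n)) (a b : Q) (u v : 'I_n -> Q),
    alpha a b -> (forall i, beta (u i) (v i)) ->
    delta (lqeval1 t a u) (lqeval1 t a v) ->
    delta (lqeval1 t b u) (lqeval1 t b v).

Definition commutator (Q : leftQuasigroupType) (alpha beta : Q -> Q -> Prop)
    (x y : Q) : Prop :=
  forall delta : Q -> Q -> Prop,
    congruence delta -> term_condition alpha beta delta -> delta x y.

(* The intersection defining [commutator] is itself a congruence satisfying the
   term condition, hence the smallest one. *)
Lemma commutator_congruence (Q : leftQuasigroupType)
  (alpha beta : Q -> Q -> Prop) : congruence (commutator alpha beta).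
Proof.
split; first split.
- by move=> x d [[r _ _] _ _] _; apply: r.
- by move=> x y xy d cd td; case: (cd) => -[_ s _] _ _; apply: s; apply: xy.
- move=> x y z xy yz d cd td; case: (cd) => -[_ _ tr] _ _.
  by apply: (tr _ y); [apply: xy | apply: yz].
- by move=> a b c e ab ce d cd td; apply: (congr_mul cd); [apply: ab|apply: ce].
- by move=> a b c e ab ce d cd td; apply: (congr_div cd); [apply: ab|apply: ce].
Qed.

Lemma commutator_term_condition (Q : leftQuasigroupType)
  (alpha beta : Q -> Q -> Prop) :
  term_condition alpha beta (commutator alpha beta).
Proof.
move=> n t a b u v ab uv h d cd td.
by apply: (td _ _ _ _ _ _ ab uv); apply: h.
Qed.

Fixpoint lower_central (Q : leftQuasigroupType) (n : nat) : Q -> Q -> Prop :=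
  match n with
  | 0 => fun _ _ => True
  | m.+1 => commutator (@lower_central Q m) (fun _ _ => True)
  end.

Definition nilpotent (Q : leftQuasigroupType) : Prop :=
  exists n : nat, forall x y : Q, lower_central n x y <-> x = y.

(* Main.v *)
Require Import Defs.
From mathcomp Require Import all_boot.
From mathcomp Require Import boolp classical_sets.

Set Implicit Arguments.
Unset Strict Implicit.
Unset Printing Implicit Defensive.

Local Open Scope quandle_scope.

(** Call a quandle latin modulo a congruence [r] when every right
    multiplication is injective and surjective up to [r].  The lower central
    series starts at the full relation, modulo which everything is latin, and
    ends at equality; so it suffices to pass from a congruence [alpha] to
    [delta = [alpha, 1]], that is, to a [delta] below [alpha] modulo which
    [alpha] is central.  Working modulo congruences of the fixed quandle [Q]
    spares the construction of quotients.

    Write [disp x y = L_x L_y^-1].  Applied to a group commutator, the term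
    condition says that [disp x y] with [alpha x y] commutes, modulo [delta],
    with all of [Dis Q] ([disp_central]).  As [Q] is connected, [Dis Q] is
    transitive ([dis_transitive]).  Conjugating by [h] in [Dis Q] turns
    [disp x y] into [disp (h x) (h y)], hence a central displacement can be
    rebased at any point: [disp x y] is [disp v z] for any prescribed [z] and
    some [v] in its [alpha]-block ([disp_rebase]).

    Injectivity: if [x * a] and [y * a] agree modulo [delta], then [alpha x y]
    because [Q] is latin modulo [alpha].  The central map [disp x y] fixes a
    point modulo [delta], hence by transitivity all points, so [L_x = L_y]
    modulo [delta].  The union of the [delta]-blocks of [x] and [y] is then a
    subalgebra acting trivially on its blocks; being connected, it is one
    block.

    Surjectivity: given [a] and [b], choose [x0] with [c = x0 * a] in the
    [alpha]-block of [b].  This block [B] is a connected subalgebra, and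
    rebasing shows that the elements [z * c] with [z] in [B] form, modulo
    [delta], a set stable under the left multiplications by [B] and their
    inverses; so [b] is some [z * c = disp z c c].  Rebasing [disp z c] at [x0]
    as [disp x x0] yields [x * a = disp x x0 (x0 * a) = b] modulo [delta]. *)

(** * Congruences and quandle identities *)

Section Congruences.
Context (Q : leftQuasigroupType) (r : Q -> Q -> Prop) (cr : congruence r).

Lemma congruence_refl x : r x x.
Proof. by case: cr => -[]. Qed.

Lemma congruence_sym x y : r x y -> r y x.
Proof. by case: cr => -[_ s _] _ _; apply: s. Qed.

Lemma congruence_trans y x z : r x y -> r y z -> r x z.
Proof. by case: cr => -[_ _ t] _ _; apply: t. Qed.

End Congruences.

Lemma lqdivxx (Q : quandleType) (x : Q) : x \\ x = x.
Proof. by rewrite -{2}(lqmulxx x) lqmulK. Qed.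

Lemma lqdivDr (Q : quandleType) (x y z : Q) :
  x \\ (y * z) = (x \\ y) * (x \\ z).
Proof. by rewrite -{1}(lqdivK x y) -{1}(lqdivK x z) -lqmulDr lqmulK. Qed.

(** Reachability under [LMlt Q] may be proved one left translation at a time:
    the stability of [P] under [L_u] and [L_u^-1] makes it invariant under the
    whole group. *)
Lemma connected_ind (Q : leftQuasigroupType) (P : Q -> Prop) :
  connected Q ->
  (forall u z, P z -> P (u * z)) -> (forall u z, P z -> P (u \\ z)) ->
  forall x y, P x -> P y.
Proof.
move=> Qc Pmul Pdiv x y; have [f ff <-] := Qc x y.
suff: forall z, P z <-> P (f z) by move=> /(_ x) [].
elim: ff => {x y f} [u z||f g _ IHf _ IHg z|f g _ IHf fK gK z] //.
- by split=> [/(Pmul u)//|/(Pdiv u)]; rewrite /left_mul lqmulK.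
- by apply: iff_trans (IHg z) (IHf _).
- by rewrite -{1}(gK z); apply: iff_sym; apply: IHf.
Qed.

Lemma superconnected_ind (Q : leftQuasigroupType) (S : subalgebra Q)
    (P : Q -> Prop) :
  superconnected Q ->
  (forall u z, subalg_set S u -> subalg_set S z -> P z -> P (u * z)) ->
  (forall u z, subalg_set S u -> subalg_set S z -> P z -> P (u \\ z)) ->
  forall x y, subalg_set S x -> subalg_set S y -> P x -> P y.
Proof.
move=> Qsc Pmul Pdiv x y Sx Sy.
pose P' (z : subalg_sort S) := P (val z).
suff /(_ (SigSub (mem_set Sx)) (SigSub (mem_set Sy))) : forall x y, P' x -> P' y
  by [].
apply: connected_ind => [|u z|u z]; first exact: Qsc.
- by apply: Pmul; apply: set_valP.
- by apply: Pdiv; apply: set_valP.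
Qed.

Lemma superconnected_indT (Q : leftQuasigroupType) (P : Q -> Prop) :
  superconnected Q ->
  (forall u z, P z -> P (u * z)) -> (forall u z, P z -> P (u \\ z)) ->
  forall x y, P x -> P y.
Proof.
move=> Qsc Pmul Pdiv x y.
pose S := @Subalgebra Q setT (fun _ _ _ _ => I) (fun _ _ _ _ => I).
apply: (@superconnected_ind _ S) => // u z _ _; [exact: Pmul|exact: Pdiv].
Qed.

(** * The displacement group *)

Definition disp (Q : leftQuasigroupType) (x y e : Q) : Q := x * (y \\ e).

(** [Dis Q], presented by words: the generating set is closed under inverses,
    as [disp b a] inverts [disp a b], so words exhaust the group. *)
Inductive dis (Q : leftQuasigroupType) : (Q -> Q) -> Prop :=
| dis_id : dis id
| dis_cons (a b : Q) (f : Q -> Q) : dis f -> dis (fun e => disp a b (f e)).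

Lemma dispK (Q : leftQuasigroupType) (x y z e : Q) :
  disp x y (disp y z e) = disp x z e.
Proof. by rewrite /disp lqmulK. Qed.

Lemma dispxx (Q : leftQuasigroupType) (x e : Q) : disp x x e = e.
Proof. exact: lqdivK. Qed.

Lemma disp_mul (Q : leftQuasigroupType) (x y e : Q) :
  disp x y (y * e) = x * e.
Proof. by rewrite /disp lqmulK. Qed.

Lemma disp_congr (Q : leftQuasigroupType) (r : Q -> Q -> Prop)
    (x y e f : Q) :
  congruence r -> r e f -> r (disp x y e) (disp x y f).
Proof.
move=> cr ref; apply: (congr_mul cr); first exact: congruence_refl.
by apply: (congr_div cr) => //; apply: congruence_refl.
Qed.

Lemma dis_congr (Q : leftQuasigroupType) (r : Q -> Q -> Prop) h (x y : Q) :
  congruence r -> dis h -> r x y -> r (h x) (h y).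
Proof. by move=> cr; elim=> // a b f _ IH /IH; apply: disp_congr. Qed.

Lemma dis_surj (Q : leftQuasigroupType) (h : Q -> Q) :
  dis h -> forall y, exists x, h x = y.
Proof.
elim=> [y|a b f _ IH y]; first by exists y.
by have [x fx] := IH (disp b a y); exists x; rewrite fx dispK dispxx.
Qed.

Lemma dis_mulE (Q : quandleType) (h : Q -> Q) :
  dis h -> {morph h : x y / x * y}.
Proof. by elim=> // a b f _ IH x y; rewrite IH /disp lqdivDr lqmulDr. Qed.

Lemma dis_dispE (Q : quandleType) (h : Q -> Q) x y e :
  dis h -> h (disp x y e) = disp (h x) (h y) (h e).
Proof.
move=> dh; rewrite /disp (dis_mulE dh); congr (_ * _).
by rewrite -{2}(lqdivK y e) (dis_mulE dh) lqmulK.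
Qed.

(** By idempotence each step [z |-> u * z] or [z |-> u \\ z] of an orbit of
    [LMlt Q] is also made by a displacement. *)
Lemma dis_transitive (Q : quandleType) (x y : Q) :
  superconnected Q -> exists2 h, dis h & h x = y.
Proof.
move=> Qsc; pose P y := exists2 h : Q -> Q, dis h & h x = y.
apply: (@superconnected_indT _ P Qsc _ _ x).
- move=> u z [h dh hx]; exists (fun e => disp u z (h e)); first exact: dis_cons.
  by rewrite hx /disp lqdivxx.
- move=> u z [h dh hx]; exists (fun e => disp (u \\ z) u (h e)).
    exact: dis_cons.
  by rewrite hx /disp lqmulxx.
- by exists id => //; apply: dis_id.
Qed.

(** * Central congruences *)

Definition latin_mod (Q : leftQuasigroupType) (r : Q -> Q -> Prop) : Prop :=
  forall a : Q, (forall x y, r (x * a) (y * a) -> r x y) /\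
    (forall b, exists x, r (x * a) b).

(** [disp z y] commutes trivially with everything at [z = y]; the term
    condition moves this to [z = x], provided commutation is stated as the
    equality of the values of one term: the group commutator of [disp z y] and
    [disp c d], at [d] and at [d = c]. *)
Lemma disp_commute (Q : leftQuasigroupType) (alpha delta : Q -> Q -> Prop) :
  congruence alpha -> congruence delta ->
  term_condition alpha (fun _ _ => True) delta ->
  forall x y c d e, alpha x y ->
  delta (disp x y (disp c d e)) (disp c d (disp x y e)).
Proof.
move=> ca cd tc x y c d e axy.
pose vz : lqterm (option 'I_4) := TVar None.
pose v i : lqterm (option 'I_4) := TVar (Some (inord i)).
pose tdisp (s t w : lqterm (option 'I_4)) := TMul s (TDiv t w).
pose t := tdisp vz (v 0) (tdisp (v 1) (v 2)
  (tdisp (v 0) vz (tdisp (v 2) (v 1) (v 3)))).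
(* At this point the inner factors cancel at [z = x], which leaves the claim. *)
pose e' := disp c d (disp x y e).
pose val d (i : 'I_4) := nth y [:: y; c; d; e'] i.
have tE z d' : lqeval1 t z (val d') =
    disp z y (disp c d' (disp y z (disp d' c e'))).
  by rewrite /lqeval1 /= /val !inordK.
have := tc 4 t y x (val d) (val c) (congruence_sym ca axy) (fun _ => I).
rewrite !tE /e' !(dispxx, dispK); apply; exact: congruence_refl.
Qed.

Section CentralStep.
Context (Q : quandleType) (Qsc : superconnected Q).
Context (alpha delta : Q -> Q -> Prop).
Context (ca : congruence alpha) (cd : congruence delta).
Context (delta_alpha : forall x y, delta x y -> alpha x y).
Context (tc : term_condition alpha (fun _ _ => True) delta).

Lemma disp_central x y h e : alpha x y -> dis h ->
  delta (disp x y (h e)) (h (disp x y e)).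
Proof.
move=> axy; elim=> [|a b f _ IH]; first exact: congruence_refl.
apply: (congruence_trans cd); first exact: (disp_commute ca).
exact: disp_congr.
Qed.

(** For [h] in [Dis Q] with [h y = z], take [v = h x]: then [disp v z] is the
    conjugate of the central [disp x y] by [h]. *)
Lemma disp_rebase x y z : alpha x y ->
  exists2 v, alpha v z & forall e, delta (disp v z e) (disp x y e).
Proof.
move=> axy; have [h dh hy] := dis_transitive y z Qsc.
exists (h x) => [|e]; first by rewrite -hy; apply: (dis_congr ca dh).
have [e' <-] := dis_surj dh e.
by rewrite -hy -dis_dispE //; apply: (congruence_sym cd); apply: disp_central.
Qed.

(** Elements with the same left translation form a projection subquandle,
    which superconnectedness collapses. *)
Lemma superconnected_faithful x y :
  (forall e, delta (x * e) (y * e)) -> delta x y.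
Proof.
move=> xy; pose S z := delta z x \/ delta z y.
have Sl u e : S u -> delta (u * e) (y * e).
  case=> uw; last by apply: (congr_mul cd) => //; apply: congruence_refl.
  apply: (congruence_trans cd (y := x * e)) => //.
  by apply: (congr_mul cd) => //; apply: congruence_refl.
have near w z : delta z w -> delta (w * z) z.
  move=> zw; apply: (congruence_trans cd (y := w * w)).
    by apply: (congr_mul cd) => //; apply: congruence_refl.
  by rewrite lqmulxx; apply: congruence_sym.
have Smul u z : S u -> S z -> delta (u * z) z.
  move=> /(Sl u z) uz [zx|/near]; apply: (congruence_trans cd uz) => //.
  exact: (congruence_trans cd (congruence_sym cd (xy z)) (near _ _ zx)).
have Sdiv u z : S u -> S z -> delta (u \\ z) z.
  move=> Su Sz; rewrite -{2}(lqmulK u z).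
  apply: (congr_div cd); first exact: congruence_refl.
  by apply: (congruence_sym cd); apply: Smul.
have Scl z z' : delta z' z -> S z -> S z'.
  by move=> z'z [] ?; [left|right]; apply: (congruence_trans cd z'z).
have SM u z (Su : S u) (Sz : S z) : S (u * z) by apply: Scl (Smul u z _ _) _.
have SD u z (Su : S u) (Sz : S z) : S (u \\ z) by apply: Scl (Sdiv u z _ _) _.
apply: (@superconnected_ind _ (Subalgebra SM SD) (delta x) Qsc _ _ x).
- move=> u z Su Sz xz; apply: (congruence_trans cd xz).
  by apply: (congruence_sym cd); apply: Smul.
- move=> u z Su Sz xz; apply: (congruence_trans cd xz).
  by apply: (congruence_sym cd); apply: Sdiv.
- by left; apply: congruence_refl.
- by right; apply: congruence_refl.
- exact: congruence_refl.
Qed.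

(** An [alpha]-block is a connected affine quandle modulo [delta]; for such a
    quandle [Aff(A, f)], connectedness means that [1 - f] is onto, that is,
    that right multiplications are. *)
Lemma block_right_mul_surj c b :
  alpha b c -> exists2 z, alpha z c & delta (z * c) b.
Proof.
move=> abc; pose P y := exists2 z, alpha z c & delta (z * c) y.
have Bmul u z : alpha u c -> alpha z c -> alpha (u * z) c.
  by move=> uc zc; rewrite -(lqmulxx c); apply: (congr_mul ca).
have Bdiv u z : alpha u c -> alpha z c -> alpha (u \\ z) c.
  by move=> uc zc; rewrite -(lqdivxx c); apply: (congr_div ca).
have cc : alpha c c by apply: congruence_refl.
apply: (@superconnected_ind _ (@Subalgebra _ (alpha^~ c) Bmul Bdiv) P Qsc
  _ _ c) => //=.
- move=> u y uc _ [z zc zy].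
  have [v vz vE] := disp_rebase (c * z) uc.
  exists v; first by apply: (congruence_trans ca vz); apply: Bmul.
  have := vE (c * (z * c)); rewrite disp_mul lqmulDr lqmulxx disp_mul.
  move=> /(congruence_trans cd); apply.
  by apply: (congr_mul cd) => //; apply: congruence_refl.
- move=> u y uc _ [z zc zy].
  have [v vz vE] := disp_rebase z (congruence_sym ca uc).
  exists (c \\ v); first by apply: Bdiv => //; apply: (congruence_trans ca vz).
  rewrite -{2}(lqdivxx c) -lqdivDr -(lqmulK c (u \\ y)).
  apply: (congr_div cd); first exact: congruence_refl.
  have := vE (z * c); rewrite disp_mul => /(congruence_trans cd); apply.
  exact: disp_congr.
- by exists c => //; rewrite lqmulxx; apply: congruence_refl.
Qed.

Lemma latin_mod_central : latin_mod alpha -> latin_mod delta.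
Proof.
move=> La a; have [Ia Sa] := La a; split=> [x y xya|b].
  have axy : alpha x y by apply: Ia; apply: delta_alpha.
  apply: superconnected_faithful => e; rewrite -(disp_mul x y e).
  have [h dh <-] := dis_transitive (y * a) (y * e) Qsc.
  apply: (congruence_trans cd); first exact: disp_central.
  by apply: (dis_congr cd dh); rewrite disp_mul.
have [x0 x0a] := Sa b.
have [z az zb] := block_right_mul_surj (congruence_sym ca x0a).
have [x _ xE] := disp_rebase x0 az.
exists x; have := xE (x0 * a); rewrite disp_mul.
by move=> /(congruence_trans cd); apply; rewrite /disp lqdivxx.
Qed.

End CentralStep.

(** * The lower central series *)

Lemma lower_central_congruence (Q : leftQuasigroupType) n :
  congruence (@lower_central Q n).
Proof. by case: n => [|n]; [split|apply: commutator_congruence]. Qed.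

Lemma commutator_subl (Q : leftQuasigroupType) (alpha beta : Q -> Q -> Prop)
    x y :
  congruence alpha -> commutator alpha beta x y -> alpha x y.
Proof.
move=> ca; apply=> // n t a b u v ab _ tuv.
have tab w : alpha (lqeval1 t a w) (lqeval1 t b w).
  rewrite /lqeval1; elim: t {tuv} => [[i|]|t1 IH1 t2 IH2|t1 IH1 t2 IH2] //=.
  - exact: congruence_refl.
  - exact: (congr_mul ca).
  - exact: (congr_div ca).
apply: (congruence_trans ca (congruence_sym ca (tab u))).
exact: (congruence_trans ca tuv).
Qed.

Lemma latin_mod_lower_central (Q : quandleType) n :
  superconnected Q -> latin_mod (@lower_central Q n).
Proof.
move=> Qsc; elim: n => [a|n IH]; first by split=> // b; exists b.
have cn := lower_central_congruence Q n.
apply: (latin_mod_central Qsc cn _ _ _ IH).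
- exact: commutator_congruence.
- by move=> x y; apply: commutator_subl.
- exact: commutator_term_condition.
Qed.

Theorem theorem2p15 (Q : quandleType) (Qnil : nilpotent Q)
  (Qsc : superconnected Q) : latin Q.
Proof.
have [n nE] := Qnil; move=> a.
have [inj surj] := latin_mod_lower_central n Qsc a.
have [g gE] := choice surj.
have gK : cancel g (right_mul a) by move=> b; apply/nE; apply: gE.
exists g => // x; apply/nE; apply: inj; apply/nE; exact: gK.
Qed.
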